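(* Let $J$ be a finite set with $m:=|J|\ge 3$, let $\Pi=(P_x)_{x\in J}$ be a partition of a finite set $P$ of participants, and let $\mathcal{Z}=(J,h,\boldsymbol g)$ be a uniform polymatroid with increment sequence $\boldsymbol g=(g_i)_{0\le i\le m}$ such that $g_0>g_1=g_{m-1}>0$ and $g_0<|P_x|$ for all $x\in J$. Let $\mathcal{P}_1(J)$ denote the collection of all one-element subsets of $J$. (1) A monotone increasing family $\Delta\subseteq\mathcal{P}(J)\setminus\{\emptyset\}$ is compatible with $\mathcal{Z}$ if and only if $\min\Delta=\{X\}$ for a certain $\emptyset\ne X\subseteq J$ or $\min\Delta=\mathcal{P}_1(J)$. (2) Let $\Delta\subseteq\mathcal{P}(J)\setminus\{\emptyset\}$ be a monotone increasing family compatible with $\mathcal{Z}$ and let $\Gamma=\Gamma(\Pi,\mathcal{Z},\Delta)$. Then (2a) if $\min\Delta=\{X\}$ for a certain $\emptyset\ne X\subseteq J$, then the hierarchical order induced by $\Gamma$ on $\Pi$ is of the type $Ord(J\setminus X,X)$; (2b) if $\min\Delta=\mathcal{P}_1(J)$, then the hierarchical order induced by $\Gamma$ on $\Pi$ is of the type $Ord(\emptyset,J)$.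
   Context: Polymatroids. For a finite set $J$ let $\mathcal{P}(J)$ be its power set. An (integer) polymatroid is a pair $(J,h)$ with $h:\mathcal{P}(J)\to\mathbb{N}_0$ such that $h(\emptyset)=0$, $h(X)\le h(Y)$ if $X\subseteq Y$, and $h(X\cap Y)+h(X\cup Y)\le h(X)+h(Y)$. It is uniform if $h(X)=h(Y)$ whenever $|X|=|Y|$; write $h_i=h(X)$ for $|X|=i$. With $m=|J|$, its increment sequence is $\boldsymbol g=(g_0,\dots,g_m)$, $g_i=h_{i+1}-h_i$ for $0\le i\le m-1$ and $g_m=0$; it is a nonincreasing sequence of nonnegative integers, and $g_0>0$ is assumed. Such a polymatroid is written $\mathcal{Z}=(J,h,\boldsymbol g)$. Compatibility. A monotone increasing family $\Delta\subseteq\mathcal{P}(J)\setminus\{\emptyset\}$ is a nonempty family of nonempty subsets of $J$ closed under taking supersets in $J$; $\min\Delta$ is the set of its inclusion-minimal members. Fix $x_0\notin J$ and define $h'$ on $\mathcal{P}(J\cup\{x_0\})$ by $h'(X)=h(X)$ for $X\subseteq J$, $h'(X\cup\{x_0\})=h(X)$ if $X\in\Delta$, and $h'(X\cup\{x_0\})=h(X)+1$ if $X\subseteq J$, $X\notin\Delta$. $\Delta$ is compatible with $\mathcal{Z}$ if $h'$ is monotone increasing and submodular. Access structure. A partition $\Pi=(P_x)_{x\in J}$ of $P$ consists of pairwise disjoint nonempty sets (blocks) with union $P$. For $A\subseteq P$ put $\pi(A)=(|A\cap P_x|)_{x\in J}\in\mathbb{N}_0^J$. For $\bar v\in\mathbb{N}_0^J$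 and $Y\subseteq J$ put $\mathrm{supp}(\bar v)=\{x:v_x\ne0\}$, $|\bar v|=\sum_{x\in J}v_x$, $|\bar v_Y|=\sum_{x\in Y}v_x$. For $X\subseteq J$ let $\mathcal{B}(\mathcal{Z},X)=\{\bar v\in\mathbb{N}_0^J:\mathrm{supp}(\bar v)\subseteq X,\ |\bar v|=h(X),\ |\bar v_Y|\le h(Y)\text{ for all }Y\subseteq X\}$. For $\Delta$ compatible with $\mathcal{Z}$, $\Gamma(\Pi,\mathcal{Z},\Delta)$ is the family of all $A\subseteq P$ such that $\pi(A)\ge\bar v$ (coordinatewise) for some $\bar v\in\bigcup_{X\in\Delta}\mathcal{B}(\mathcal{Z},X)$. Hierarchy. For participants $p,q\in P$ write $q\preccurlyeq p$ if $A\cup\{p\}\in\Gamma$ for all $A\subseteq P\setminus\{p,q\}$ with $A\cup\{q\}\in\Gamma$. For blocks, $P_y\preccurlyeq P_x$ means $q\preccurlyeq p$ for some (equivalently, all) $q\in P_y$, $p\in P_x$; this is a preorder on $\Pi$. For disjoint $Y,X\subseteq J$, the preorder $\preccurlyeq$ on $\Pi$ is of type $Ord(Y,X)$ if for all $a,b\in J$: $P_b\preccurlyeq P_a$ if and only if ($a=b$) or ($b\in Y$ and $a\in X$). *)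

(* Defs.v *)
From mathcomp Require Import all_boot.
Set Implicit Arguments.
Unset Strict Implicit.
Unset Printing Implicit Defensive.

Section Polymatroid.
Variable J : finType.
Implicit Types (h : {set J} -> nat) (X Y : {set J}) (Delta : {set {set J}}).

Definition increasing h : Prop := forall X Y, X \subset Y -> h X <= h Y.

Definition submodular h : Prop :=
  forall X Y, h (X :&: Y) + h (X :|: Y) <= h X + h Y.

Definition polymatroid h : Prop := [/\ h set0 = 0, increasing h & submodular h].

Definition uniform h : Prop := forall X Y, #|X| = #|Y| -> h X = h Y.

(* For uniform h this reads g_i = h_{i+1} - h_i for i < |J|, with i = #|X|,
   written additively to avoid truncated subtraction, and g_{|J|} = 0. *)
Definition increment_sequence h (g : #|J|.+1.-tuple nat) : Prop :=
  (forall X Y, #|Y| = #|X|.+1 -> h Y = h X + nth 0 g #|X|) /\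
  nth 0 g #|J| = 0.

Definition uniform_polymatroid h (g : #|J|.+1.-tuple nat) : Prop :=
  [/\ polymatroid h, uniform h, increment_sequence h g & 0 < nth 0 g 0].

Definition increasing_family Delta : Prop :=
  [/\ Delta != set0, set0 \notin Delta &
      forall X Y, X \in Delta -> X \subset Y -> Y \in Delta].

Definition minimal_sets Delta : {set {set J}} :=
  [set X : {set J} | minset (fun Y : {set J} => Y \in Delta) X].

Definition singletons : {set {set J}} := [set X : {set J} | #|X| == 1].

(* J together with a new point x0 is modelled by option J, with x0 = None. *)
Definition extension h Delta (X : {set option J}) : nat :=
  let X' := [set x | Some x \in X] in
  if (None \in X) && (X' \notin Delta) then (h X').+1 else h X'.

End Polymatroid.

Definition compatible (J : finType) (h : {set J} -> nat)
    (Delta : {set {set J}}) : Prop :=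
  increasing (extension h Delta) /\ submodular (extension h Delta).

Definition supp (J : finType) (v : {ffun J -> nat}) : {set J} :=
  [set x | v x != 0].

Definition base (J : finType) (h : {set J} -> nat) (X : {set J})
    (v : {ffun J -> nat}) : Prop :=
  [/\ supp v \subset X, \sum_(x : J) v x = h X &
      forall Y : {set J}, Y \subset X -> \sum_(x in Y) v x <= h Y].

Section Access.
Variables (J P : finType) (Pi : J -> {set P}).

(* finset.partition is about sets of blocks; here the blocks are indexed. *)
Definition partition_family : Prop :=
  [/\ forall x, Pi x != set0,
      forall x y, x != y -> [disjoint Pi x & Pi y] &
      \bigcup_(x : J) Pi x = [set: P]].

Definition profile (A : {set P}) : {ffun J -> nat} :=
  [ffun x => #|A :&: Pi x|].

Definition access_structure (h : {set J} -> nat) (Delta : {set {set J}})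
    (A : {set P}) : Prop :=
  exists X v, [/\ X \in Delta, base h X v & forall x, v x <= profile A x].

Definition participant_le (Gamma : {set P} -> Prop) (q p : P) : Prop :=
  forall A : {set P}, A \subset ~: [set p; q] ->
    Gamma (q |: A) -> Gamma (p |: A).

(* When Gamma A depends only on profile A, as for access_structure, the choice
   of the representatives q and p is immaterial. *)
Definition block_le (Gamma : {set P} -> Prop) (y x : J) : Prop :=
  exists q p, [/\ q \in Pi y, p \in Pi x & participant_le Gamma q p].

End Access.

Definition Ord_type (J : finType) (le : J -> J -> Prop) (Y X : {set J}) : Prop :=
  [disjoint Y & X] /\
  forall a b : J, le b a <-> a = b \/ (b \in Y /\ a \in X).

(* Main.v *)
(** Write [b = g_1] and [c = g_0 - g_1].  Submodularity makes [g] nonincreasing,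
    so [h Y = c + b * #|Y|] for every nonempty [Y].  Hence [h] is modular on
    intersecting pairs and has slack [c > 0] on disjoint ones, so compatibility
    means that [Delta] is closed under nonempty intersections, which leaves only
    a principal family or the family of all nonempty sets.  In both cases
    [Delta] consists of the nonempty sets containing some [X] ([X = set0] in the
    second one), and [A] is qualified iff its profile [u] satisfies [b <= u x]
    on [X] and [c <= \sum_x (u x - b)] (truncated subtraction); the
    hierarchical order is read off this criterion. *)
Require Import Defs.
From mathcomp Require Import all_boot zify.

Set Implicit Arguments.
Unset Strict Implicit.
Unset Printing Implicit Defensive.

(** * Subsets of given size and vectors of given sum *)

Lemma exists_subset_card (T : finType) (S : {set T}) (k : nat) :
  k <= #|S| -> exists2 A : {set T}, A \subset S & #|A| = k.
Proof.
move=> kS; exists [set x in take k (enum S)].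
  by apply/subsetP=> x; rewrite inE => /mem_take; rewrite mem_enum.
rewrite cardsE; have /card_uniqP -> := take_uniq k (enum_uniq S).
by rewrite size_take -cardE; case: ltngtP kS.
Qed.

(** A discrete intermediate value argument: starting from [l], some coordinate below [u] can be
    raised by one until the sum reaches [N]. *)
Lemma sum_interpolation (T : finType) (l u : T -> nat) (N : nat) :
  (forall x, l x <= u x) -> \sum_x l x <= N -> N <= \sum_x u x ->
  exists v : {ffun T -> nat},
    (forall x, l x <= v x <= u x) /\ \sum_x v x = N.
Proof.
move=> lu; elim: N => [|N IH] lN Nu.
  exists [ffun x => l x]; split=> [x|]; first by rewrite ffunE leqnn lu.
  by under eq_bigr do rewrite ffunE; lia.
have [lN'|lN'] := leqP (\sum_x l x) N; last first.
  exists [ffun x => l x]; split=> [x|]; first by rewrite ffunE leqnn lu.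
  by under eq_bigr do rewrite ffunE; lia.
have [v [lvu vN]] := IH lN' (ltnW Nu).
have /existsP[x vux] : [exists x, v x < u x].
  apply: contraTT Nu; rewrite negb_exists => /forallP uv.
  by rewrite -leqNgt -vN leq_sum // => x _; rewrite leqNgt uv.
exists [ffun y => v y + (y == x)]; split=> [y|].
  by rewrite ffunE; have := lvu y; case: eqVneq => [->|_]; lia.
under eq_bigr do rewrite ffunE.
rewrite big_split /= vN; suff -> : \sum_y (y == x : nat) = 1 by lia.
by rewrite (bigD1 x) //= eqxx big1 // => y /negPf ->.
Qed.

(** * Uniform polymatroids with constant increments *)

(** The empty set is separate because the affine formula would give it [c]; this jump is the source
    of all the slack in submodularity. *)
Definition affine_rank (J : finType) (h : {set J} -> nat) (b c : nat) : Prop :=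
  h set0 = 0 /\ forall Y, Y != set0 -> h Y = c + b * #|Y|.

(** Submodularity for [x |: X] and [y |: X], where [#|X| = i] and [x], [y] are distinct points
    outside [X]. *)
Lemma increment_nonincreasing (J : finType) (h : {set J} -> nat)
    (g : #|J|.+1.-tuple nat) (i : nat) :
  submodular h -> increment_sequence h g -> i.+1 < #|J| ->
  nth 0 g i.+1 <= nth 0 g i.
Proof.
move=> subh [hg _] iJ.
have [|X _ Xi] := @exists_subset_card J setT i; first by rewrite cardsT; lia.
have /card_gt1P[x [y [xX yX xy]]] : 1 < #|~: X|.
  by have := cardsC X; lia.
rewrite !inE in xX yX.
have cx : #|x |: X| = i.+1 by rewrite cardsU1 xX Xi.
have cy : #|y |: X| = i.+1 by rewrite cardsU1 yX Xi.
have cxy : #|(x |: X) :|: (y |: X)| = i.+2.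
  have -> : (x |: X) :|: (y |: X) = x |: (y |: X).
    by apply/setP=> z; rewrite !inE; case: (z == x); case: (z == y); case: (z \in X).
  by rewrite cardsU1 !inE (negPf xy) (negPf xX) cy.
have IX : (x |: X) :&: (y |: X) = X.
  apply/setP=> z; rewrite !inE; have [->|] := eqVneq z x => /=.
    by rewrite (negPf xy) (negPf xX).
  by case: (z \in X); rewrite ?orbT // andbF.
have := subh (x |: X) (y |: X); rewrite IX.
have := hg (x |: X) ((x |: X) :|: (y |: X)); rewrite cxy cx => /(_ erefl).
by have := hg X (y |: X); rewrite cy Xi => /(_ erefl); lia.
Qed.

Lemma uniform_affine_rank (J : finType) (h : {set J} -> nat)
    (g : #|J|.+1.-tuple nat) :
  uniform_polymatroid h g -> nth 0 g 1 < nth 0 g 0 ->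
  nth 0 g 1 = nth 0 g #|J|.-1 ->
  affine_rank h (nth 0 g 1) (nth 0 g 0 - nth 0 g 1).
Proof.
move=> [[h0 _ subh] _ hg _] g10 g1m; split=> // Y.
have mono j : forall i, i + j < #|J| -> nth 0 g (i + j) <= nth 0 g i.
  elim: j => [|j IH] i ij; first by rewrite addn0.
  rewrite addnS in ij *; apply: leq_trans (increment_nonincreasing subh hg ij) _.
  exact: IH (ltnW ij).
(* The nonincreasing sequence is squeezed between its equal values at [1] and [#|J|.-1]. *)
have gE i : 0 < i < #|J| -> nth 0 g i = nth 0 g 1.
  move=> iJ; apply/eqP; rewrite eqn_leq; apply/andP; split.
    by have := mono i.-1 1; rewrite add1n prednK; [apply; lia | lia].
  by rewrite g1m; have := mono (#|J|.-1 - i) i; rewrite subnKC; [apply; lia | lia].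
case: hg => hg _.
have: 0 < #|Y| -> h Y = nth 0 g 0 - nth 0 g 1 + nth 0 g 1 * #|Y|.
  move: {2}(#|Y|) (leqnn #|Y|) => n; elim: n Y => [|n IH] Y Yn Y0; first by lia.
  have /card_gt0P[y yY] := Y0.
  have cY : #|Y| = #|Y :\ y|.+1 by rewrite (cardsD1 y Y) yY.
  (* The first point contributes [g_0], which is [c + b]; every later point contributes [b]. *)
  rewrite (hg _ _ cY); have [Yy0|Yy0] := posnP #|Y :\ y|.
    by rewrite cY Yy0 (cards0_eq Yy0) h0; lia.
  have YJ : #|Y| <= #|J| by apply: max_card.
  have -> := gE #|Y :\ y|; last by lia.
  have -> := IH (Y :\ y); [nia | lia | by []].
by rewrite card_gt0.
Qed.

(** * Compatible families *)

Lemma compatible_affineP (J : finType) (h : {set J} -> nat) (b c : nat)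
    (Delta : {set {set J}}) :
  affine_rank h b c -> 0 < b -> 0 < c -> increasing_family Delta ->
  compatible h Delta <->
  {in Delta &, forall X Y, X :&: Y != set0 -> X :&: Y \in Delta}.
Proof.
move=> [h0 hE] b0 c0 [_ D0 Dup]; split=> [[_ subh] X Y XD YD XY|DI].
  apply: contraT => XYD.
  (* Submodularity is tested on [X] and [Y] with the new point added: were [X :&: Y] outside
     [Delta], the left side would gain a unit, yet [h] is modular on intersecting pairs. *)
  pose ext (Z : {set J}) : {set option J} := None |: Some @: Z.
  have extE Z : extension h Delta (ext Z) = h Z + (Z \notin Delta).
    rewrite /extension; have -> : [set x | Some x \in ext Z] = Z.
      by apply/setP=> x; rewrite !inE /= mem_imset // => ? ? [].
    by rewrite !inE /=; case: (Z \in Delta) => /=; lia.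
  have extI : ext X :&: ext Y = ext (X :&: Y).
    by rewrite /ext imsetI -?setUIr // => ? ? _ _ [].
  have extU : ext X :|: ext Y = ext (X :|: Y).
    by rewrite /ext imsetU setUACA setUid.
  have := subh (ext X) (ext Y); rewrite extI extU !extE XD YD XYD.
  rewrite (Dup X) ?subsetUl //= !hE //.
  - by have := cardsUI X Y; nia.
  - by apply: contraNneq D0 => <-.
  - by apply: contraNneq D0 => <-.
  by apply: contraNneq D0 => XY0; rewrite -XY0 (Dup X) ?subsetUl.
(* Strict growth compensates for the unit lost when a larger set enters [Delta]. *)
have h_mono (X Y : {set J}) : X \subset Y -> h X + (X != Y) <= h Y.
  move=> XY; have [->|nXY] := eqVneq X Y; first by rewrite addn0.
  have /proper_card ltXY : X \proper Y by rewrite properEneq nXY.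
  rewrite (hE Y) -?card_gt0; last by lia.
  by have [->|/hE ->] := eqVneq X set0; [rewrite h0 | ]; nia.
(* The spare unit on disjoint nonempty pairs pays for two members of [Delta] whose intersection is
   empty, hence not in [Delta]. *)
have h_slack (X Y : {set J}) : h (X :&: Y) + h (X :|: Y)
    + [&& X != set0, Y != set0 & X :&: Y == set0] <= h X + h Y.
  have [->|X0] := eqVneq X set0; first by rewrite set0I set0U h0; lia.
  have [->|Y0] := eqVneq Y set0; first by rewrite setI0 setU0 h0; lia.
  have U0 : X :|: Y != set0 by rewrite setU_eq0 negb_and X0.
  have := cardsUI X Y; rewrite (hE _ U0) (hE _ X0) (hE _ Y0).
  by have [->|/hE ->] := eqVneq (X :&: Y) set0; rewrite ?h0 ?cards0 /=; nia.
split=> S T.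
  move=> /subsetP ST; rewrite /extension.
  set X := [set x | Some x \in S]; set Y := [set x | Some x \in T].
  have XY : X \subset Y by apply/subsetP=> x; rewrite !inE; apply: ST.
  have hXY := h_mono _ _ XY.
  case: (boolP (None \in S)) => [/ST -> /=|_ /=]; last by case: ifP; lia.
  have [XY0|nXY] := eqVneq X Y; first by rewrite XY0.
  by rewrite nXY in hXY; case: ifP; case: ifP; lia.
rewrite /extension !inE.
set X := [set x | Some x \in S]; set Y := [set x | Some x \in T].
have -> : [set x | Some x \in S :&: T] = X :&: Y.
  by apply/setP=> x; rewrite !inE.
have -> : [set x | Some x \in S :|: T] = X :|: Y.
  by apply/setP=> x; rewrite !inE.
have slack := h_slack X Y; have DIXY := DI X Y.
have XU := Dup X (X :|: Y); rewrite subsetUl in XU.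
have YU := Dup Y (X :|: Y); rewrite subsetUr in YU.
have IX := Dup (X :&: Y) X; rewrite subsetIl in IX.
have IY := Dup (X :&: Y) Y; rewrite subsetIr in IY.
have X0 : X \in Delta -> X != set0 by apply: contraTneq => ->.
have Y0 : Y \in Delta -> Y != set0 by apply: contraTneq => ->.
by case: (X \in Delta) XU IX DIXY X0; case: (Y \in Delta) YU IY Y0;
  case: (X :&: Y \in Delta); case: (X :|: Y \in Delta);
  case: (None \in S); case: (None \in T) => //=; lia.
Qed.

Lemma mem_minimal_principal (J : finType) (Delta : {set {set J}})
    (X : {set J}) :
  increasing_family Delta -> minimal_sets Delta = [set X] ->
  forall Z, (Z \in Delta) = (X \subset Z).
Proof.
move=> [_ _ Dup] mX Z; apply/idP/idP => [ZD|XZ].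
  have [Y Ymin YZ] := minset_exists (P := fun Y : {set J} => Y \in Delta) ZD.
  have: Y \in minimal_sets Delta by rewrite inE.
  by rewrite mX => /set1P <-.
apply: Dup XZ; have: X \in minimal_sets Delta by rewrite mX set11.
by rewrite inE => /minsetp.
Qed.

Lemma mem_minimal_singletons (J : finType) (Delta : {set {set J}}) :
  increasing_family Delta -> minimal_sets Delta = singletons J ->
  forall Z, (Z \in Delta) = (Z != set0).
Proof.
move=> [_ D0 Dup] mX Z; apply/idP/idP => [|/set0Pn[z zZ]].
  by apply: contraTneq => ->.
apply: (Dup [set z]); last by rewrite sub1set.
have: [set z] \in minimal_sets Delta by rewrite mX inE cards1.
by rewrite inE => /minsetp.
Qed.

(** Two distinct minimal sets are disjoint; enlarging members by a point then forces both to be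
    singletons, and in turn puts every singleton in [Delta]. *)
Lemma intersection_closed_minimal (J : finType) (Delta : {set {set J}}) :
  increasing_family Delta ->
  {in Delta &, forall X Y, X :&: Y != set0 -> X :&: Y \in Delta} <->
  (exists2 X : {set J}, X != set0 & minimal_sets Delta = [set X]) \/
  minimal_sets Delta = singletons J.
Proof.
move=> incD; have [Dn D0 Dup] := incD.
have nz X : X \in Delta -> X != set0 by apply: contraTneq => ->.
split=> [DI|[[X _ mX]|mX] U V]; first last.
- by rewrite !(mem_minimal_singletons incD mX).
- by rewrite !(mem_minimal_principal incD mX) subsetI => -> ->.
have [Z ZD] := set0Pn _ Dn.
have [X Xmin XZ] := minset_exists (P := fun Y : {set J} => Y \in Delta) ZD.
have XD := minsetp Xmin.
have [mX|] := eqVneq (minimal_sets Delta) [set X].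
  by left; exists X => //; apply: nz.
rewrite eqEsubset sub1set inE Xmin andbT => /subsetPn[Y].
rewrite !inE => Ymin YX; have YD := minsetp Ymin; right.
(* The member [x |: V] meets [U] only in [x], so [[set x]] is in [Delta] and minimality of [U]
   applies. *)
have one U V : minset (fun Y : {set J} => Y \in Delta) U -> V \in Delta ->
    U != V -> U :&: V = set0 -> forall x, x \in U -> U = [set x].
  move=> Umin VD _ UV0 x xU; have UD := minsetp Umin.
  have UI : U :&: (x |: V) = [set x].
    by rewrite setIUr UV0 setU0; apply/setIidPr; rewrite sub1set.
  have xD : [set x] \in Delta.
    rewrite -UI; apply: DI => //; first exact: Dup VD (subsetUr _ _).
    by rewrite UI -card_gt0 cards1.
  by apply/esym/(minsetinf Umin xD); rewrite sub1set.
have XY0 : X :&: Y = set0.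
  apply/eqP; apply: contraNT YX => XY; have ID := DI _ _ XD YD XY.
  by rewrite -(minsetinf Xmin ID) ?subsetIl // {1}(minsetinf Ymin ID) ?subsetIr.
have [x xX] := set0Pn _ (nz _ XD); have [y yY] := set0Pn _ (nz _ YD).
have XE : X = [set x] by apply: (one X Y) => //; rewrite eq_sym.
have YE : Y = [set y] by apply: (one Y X) => //; rewrite setIC.
have xy : x != y by apply: contraNneq YX => xy; rewrite XE YE xy.
have sing z : [set z] \in Delta.
  have [->|zx] := eqVneq z x; first by rewrite -XE.
  have [->|zy] := eqVneq z y; first by rewrite -YE.
  (* Two members of [Delta], built from the disjoint [X] and [Y], that share only [z]. *)
  have I : (z |: X) :&: (z |: Y) = [set z] by rewrite -setUIr XY0 setU0.
  rewrite -I; apply: DI; rewrite ?I -?card_gt0 ?cards1 //.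
    exact: Dup XD (subsetUr _ _).
  exact: Dup YD (subsetUr _ _).
apply/setP=> U; rewrite !inE; apply/idP/cards1P => [Umin|[z ->]].
  have [z zU] := set0Pn _ (nz _ (minsetp Umin)); exists z.
  by apply/esym/(minsetinf Umin (sing z)); rewrite sub1set.
apply/minsetP; split=> // V VD; rewrite subset1 => /orP[/eqP //|/eqP V0].
by rewrite V0 (negPf D0) in VD.
Qed.

(** * Qualified sets *)

(** The rank bound on [X :\ x] leaves at least [b] for [v x]; conversely, [b] on each point of
    [X :\: Y] leaves at most [h Y] for [Y]. *)
Lemma base_affine (J : finType) (h : {set J} -> nat) (b c : nat)
    (X : {set J}) (v : {ffun J -> nat}) :
  affine_rank h b c -> X != set0 ->
  base h X v <-> [/\ supp v \subset X, forall x, x \in X -> b <= v x &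
                     \sum_x v x = c + b * #|X|].
Proof.
move=> [h0 hE] X0.
have supp_sum : supp v \subset X -> \sum_x v x = \sum_(x in X) v x.
  move=> /subsetP vX; rewrite [RHS]big_mkcond; apply: eq_bigr => x _.
  by case: ifP => // /negbT; apply: contraNeq => vx; apply: vX; rewrite inE.
split=> [[vX vh vY]|[vX vb vh]]; split=> //.
- move=> x xX; have := vY (X :\ x) (subD1set _ _).
  rewrite supp_sum // (big_setD1 x) //= hE // (cardsD1 x X) xX in vh.
  (* If [X] is the singleton of [x], the affine formula does not apply to [X :\ x], but [v x] is
     then [c + b]. *)
  have [/cards0_eq E|] := posnP #|X :\ x|; last first.
    by rewrite card_gt0 => /hE ->; lia.
  by rewrite E h0 cards0 big_set0 in vh *; lia.
- by rewrite vh hE.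
- by rewrite vh hE.
move=> Y YX; have [->|Y0] := eqVneq Y set0; first by rewrite big_set0.
rewrite hE //; rewrite supp_sum // (big_setID Y) /= (setIidPr YX) in vh.
have: b * #|X :\: Y| <= \sum_(x in X :\: Y) v x.
  rewrite mulnC -sum_nat_const; apply: leq_sum => x; rewrite inE => /andP[_].
  exact: vb.
by have := cardsID Y X; rewrite (setIidPr YX); nia.
Qed.

(** The total excess over [b] must supply the constant [c]. Allowing [X = set0] treats both kinds of
    compatible families at once. *)
Lemma access_affineP (J P : finType) (Pi : J -> {set P})
    (h : {set J} -> nat) (b c : nat) (Delta : {set {set J}}) (X : {set J})
    (A : {set P}) :
  affine_rank h b c -> 0 < c ->
  (forall Z, (Z \in Delta) = (Z != set0) && (X \subset Z)) ->
  access_structure Pi h Delta A <->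
  (forall x, x \in X -> b <= profile Pi A x) /\
  c <= \sum_x (profile Pi A x - b).
Proof.
move=> hE c0 DE; set u := profile Pi A; split.
  move=> [Z [v [ZD /(base_affine _ hE)]]]; move: ZD; rewrite DE.
  move=> /andP[Z0 XZ] /(_ Z0)[vZ vb vs] vu; split=> [x xX|].
    by rewrite (leq_trans _ (vu x)) // vb // (subsetP XZ).
  suff: \sum_x v x <= \sum_x (u x - b) + \sum_(x in Z) b.
    by rewrite vs sum_nat_const; lia.
  rewrite [\sum_(x in Z) b]big_mkcond -big_split; apply: leq_sum => x _ /=.
  have := vu x; case: ifP => [_|/negbT xZ _]; first by rewrite /u; lia.
  suff -> : v x = 0 by [].
  by apply/eqP; apply: contraNT xZ => vx; apply: (subsetP vZ); rewrite inE.
(* Coordinates below [b] have no excess, so this [Z] captures all of it. *)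
move=> [ub cs]; pose Z := [set x | b <= u x].
have XZ : X \subset Z by apply/subsetP=> x xX; rewrite inE ub.
have Z0 : Z != set0.
  apply: contraTneq cs => Z0; rewrite big1 ?leqn0 -?lt0n // => x _.
  by have := in_set0 x; rewrite -Z0 inE; lia.
have bZ : \sum_x (if x \in Z then b else 0) = b * #|Z|.
  by rewrite -big_mkcond sum_nat_const mulnC.
(* A base of [Z] is any vector between [b] and [u] on [Z], zero elsewhere, with total [h Z]. *)
have [x|||v [lvu vs]] := @sum_interpolation J
    (fun x => if x \in Z then b else 0) (fun x => if x \in Z then u x else 0)
    (c + b * #|Z|).
- by rewrite inE; case: ifP.
- by rewrite bZ; lia.
- rewrite (leq_trans (leq_add cs (leqnn _))) // -bZ -big_split.
  by apply: leq_sum => x _ /=; rewrite inE; case: ifP; lia.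
exists Z, v; split; first by rewrite DE Z0.
  apply/(base_affine _ hE Z0); split=> // [|x xZ].
    apply/subsetP=> x; rewrite !inE; apply: contraNT => xZ.
    by have := lvu x; rewrite inE (negPf xZ); lia.
  by have /andP[] := lvu x; rewrite xZ.
by move=> x; have := lvu x; case: ifP => _; rewrite /u; lia.
Qed.

(** * The hierarchical order *)

Lemma partition_family_mem (J P : finType) (Pi : J -> {set P}) (y z : J)
    (q : P) :
  partition_family Pi -> q \in Pi y -> (q \in Pi z) = (z == y).
Proof.
move=> [_ dis _] qy; apply/idP/eqP => [qz|->] //.
by apply/eqP; apply: contraLR qz => zy; rewrite (disjointFl (dis _ _ zy)).
Qed.

Lemma profileU1 (J P : finType) (Pi : J -> {set P}) (A : {set P}) (y z : J)
    (q : P) :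
  partition_family Pi -> q \in Pi y -> q \notin A ->
  profile Pi (q |: A) z = (z == y) + profile Pi A z.
Proof.
move=> Pip qy qA; rewrite !ffunE setIUl.
have := partition_family_mem z Pip qy; case: (z == y) => qz.
  have -> : [set q] :&: Pi z = [set q] by apply/setIidPl; rewrite sub1set.
  by rewrite cardsU1 inE (negPf qA).
suff -> : [set q] :&: Pi z = set0 by rewrite set0U.
by apply/eqP; rewrite setI_eq0 disjoints1 qz.
Qed.

Lemma exists_profile (J P : finType) (Pi : J -> {set P}) (D : {set P})
    (w : J -> nat) :
  partition_family Pi -> (forall z, w z <= #|Pi z :\: D|) ->
  exists2 A : {set P}, A \subset ~: D & forall z, profile Pi A z = w z.
Proof.
move=> Pip wP.
have /fin_all_exists[S SE] : forall z, exists S : {set P},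
    S \subset Pi z :\: D /\ #|S| = w z.
  by move=> z; have [S SP Sw] := exists_subset_card (wP z); exists S.
exists (\bigcup_z S z) => [|z].
  apply/bigcupsP => z _; have [/subset_trans -> //] := SE z.
  by apply/subsetP=> x; rewrite !inE => /andP[].
rewrite ffunE -(SE z).2; congr #|pred_of_set _|; apply/setP=> x; rewrite inE.
apply/andP/idP => [[/bigcupP[t _ xt] xz]|xS].
  have /subsetP/(_ _ xt) := (SE t).1; rewrite inE => /andP[_ xPt].
  by move: xz; rewrite (partition_family_mem z Pip xPt) => /eqP ->.
split; first by apply/bigcupP; exists z.
by have /subsetP/(_ _ xS) := (SE z).1; rewrite inE => /andP[].
Qed.

(** By the criterion for qualified sets, the order reduces to moving one unit of a profile from [y]
    to [x]; two test profiles rule out all other relations. *)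
Lemma block_le_affineP (J P : finType) (Pi : J -> {set P})
    (h : {set J} -> nat) (b c : nat) (Delta : {set {set J}}) (X : {set J})
    (y x : J) :
  partition_family Pi -> affine_rank h b c -> 0 < b -> 0 < c ->
  (forall z, b + c < #|Pi z|) ->
  (forall Z, (Z \in Delta) = (Z != set0) && (X \subset Z)) ->
  block_le Pi (access_structure Pi h Delta) y x <->
  x = y \/ (y \notin X /\ x \in X).
Proof.
move=> Pip hE b0 c0 bP DE; have accE A := access_affineP Pi A hE c0 DE.
have [Pi0 Pdis _] := Pip.
split=> [[q [p [qy px le_qp]]]|]; last first.
  case=> [->|[yX xX]].
    by have [q qy] := set0Pn _ (Pi0 y); exists q, q; split.
  have [q qy] := set0Pn _ (Pi0 y); have [p px] := set0Pn _ (Pi0 x).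
  exists q, p; split=> // A /subsetP Apq.
  have qA : q \notin A by apply/negP=> /Apq; rewrite !inE eqxx orbT.
  have pA : p \notin A by apply/negP=> /Apq; rewrite !inE eqxx.
  have yx : y != x by apply: contraNneq yX => ->.
  have uq z := profileU1 z Pip qy qA; have up z := profileU1 z Pip px pA.
  move=> /accE[ub us]; apply/accE; split=> [z zX|].
    have zy : z != y by apply: contraNneq yX => <-.
    by have := ub z zX; rewrite uq up (negPf zy); lia.
  (* Coordinate [x] already holds at least [b], so its excess grows by exactly one, while that of
     [y] drops by at most one. *)
  apply: leq_trans us _.
  rewrite (bigD1 x) // (bigD1 y) //= [leqRHS](bigD1 x) // (bigD1 y) //=.
  rewrite (eq_bigr (fun z => profile Pi (p |: A) z - b)); last first.
    by move=> z /andP[/negPf zx /negPf zy]; rewrite uq up zx zy.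
  have := ub x xX; rewrite !uq !up !eqxx (negPf yx) eq_sym (negPf yx).
  by rewrite !addnA leq_add2r; lia.
have [->|xy] := eqVneq x y; [by left | right].
(* As [p] and [q] lie in different blocks, each block loses at most one point, which the strict
   bound on its size allows. *)
have bD z w : w <= b + c -> w <= #|Pi z :\: [set p; q]|.
  move=> /leq_trans; apply; rewrite cardsD.
  suff: #|Pi z :&: [set p; q]| <= 1 by have := bP z; lia.
  have [zx|zx] := eqVneq z x.
    rewrite -(cards1 p); apply/subset_leq_card/subsetP => t; rewrite !inE.
    move=> /andP[tz /orP[//|/eqP tq]]; move: tz.
    by rewrite tq (partition_family_mem z Pip qy) zx (negPf xy).
  rewrite -(cards1 q); apply/subset_leq_card/subsetP => t; rewrite !inE.
  move=> /andP[tz /orP[/eqP tp|//]]; move: tz.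
  by rewrite tp (partition_family_mem z Pip px) (negPf zx).
(* The relation restated for profiles: every [w] bounded by [b + c] is realized by a set avoiding
   [p] and [q]. *)
suff sep w : (forall z, w z <= b + c) ->
    (forall z, z \in X -> b <= (z == y) + w z) ->
    c <= \sum_z ((z == y) + w z - b) ->
    (forall z, z \in X -> b <= (z == x) + w z) /\
    c <= \sum_z ((z == x) + w z - b).
  have yx : y != x by rewrite eq_sym.
  have yX : y \notin X.
    apply/negP => yX.
    (* With [q], [y] just reaches [b] and [x] supplies the excess [c]; with [p] instead, [y] stays
       below [b]. *)
    have [z|z zX||] := sep (fun z => if z == y then b.-1 else
                          if z == x then b + c else b).
    - by case: (z == y); case: (z == x); lia.
    - by case: (z == y); case: (z == x); lia.
    - by rewrite (bigD1 x) //= eqxx (negPf xy); lia.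
    by move=> /(_ y yX); rewrite eqxx (negPf yx); lia.
  split=> //; apply: contraT => xX.
  (* With [q], all the excess [c] sits at [y]; with [p] it drops to [c - 1], since a single unit at
     [x] does not exceed [b]. *)
  have [z|z zX||_] := sep (fun z => if z == y then (b + c).-1 else
                          if z == x then 0 else b).
  - by case: (z == y); case: (z == x); lia.
  - have zx : z != x by apply: contraNneq xX => <-.
    by rewrite (negPf zx); case: (z == y); lia.
  - by rewrite (bigD1 y) //= eqxx; lia.
  rewrite (bigD1 y) //= eqxx (negPf yx) big1 ?addn0; first by lia.
  by move=> z /negPf ->; case: (z == x); lia.
move=> wbc wX wc.
have [A Apq Aw] := exists_profile Pip (fun z => bD z _ (wbc z)).
have qA : q \notin A.
  by apply/negP=> /(subsetP Apq); rewrite !inE eqxx orbT.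
have pA : p \notin A by apply/negP=> /(subsetP Apq); rewrite !inE eqxx.
have uq z := profileU1 z Pip qy qA; have up z := profileU1 z Pip px pA.
have [|ub us] := (accE _).1 (le_qp A Apq _).
  apply/accE; split=> [z zX|]; first by rewrite uq Aw wX.
  by under eq_bigr do rewrite uq Aw.
split=> [z zX|]; first by have := ub z zX; rewrite up Aw.
by under eq_bigr do rewrite -Aw -up.
Qed.

Theorem theorem4p9 (J P : finType) (Pi : J -> {set P})
    (h : {set J} -> nat) (g : #|J|.+1.-tuple nat)
    (J_ge3 : 3 <= #|J|)
    (Pi_partition : partition_family Pi)
    (Z_uniform : uniform_polymatroid h g)
    (g1_lt_g0 : nth 0 g 1 < nth 0 g 0)
    (g1_eq : nth 0 g 1 = nth 0 g #|J|.-1)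
    (g_last_gt0 : 0 < nth 0 g #|J|.-1)
    (g0_lt_block : forall x : J, nth 0 g 0 < #|Pi x|) :
  (forall Delta : {set {set J}}, increasing_family Delta ->
    (compatible h Delta <->
      (exists2 X : {set J}, X != set0 & minimal_sets Delta = [set X]) \/
      minimal_sets Delta = singletons J)) /\
  (forall Delta : {set {set J}}, increasing_family Delta ->
    compatible h Delta ->
    (forall X : {set J}, X != set0 -> minimal_sets Delta = [set X] ->
      Ord_type (block_le Pi (access_structure Pi h Delta)) (~: X) X) /\
    (minimal_sets Delta = singletons J ->
      Ord_type (block_le Pi (access_structure Pi h Delta)) set0 [set: J])).
Proof.
have hE := uniform_affine_rank Z_uniform g1_lt_g0 g1_eq.
have b0 : 0 < nth 0 g 1 by rewrite g1_eq.
have c0 : 0 < nth 0 g 0 - nth 0 g 1 by rewrite subn_gt0.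
have bP z : nth 0 g 1 + (nth 0 g 0 - nth 0 g 1) < #|Pi z|.
  by rewrite subnKC // ltnW.
split=> Delta incD.
  by rewrite (compatible_affineP hE) // intersection_closed_minimal.
move=> _; split=> [X X0 mX|mX]; split.
- by rewrite disjoints_subset.
- move=> y x; rewrite (@block_le_affineP J P Pi h _ _ Delta X x y Pi_partition hE) //.
    by rewrite inE.
  move=> Z; rewrite (mem_minimal_principal incD mX).
  by apply/idP/andP => [XZ|[]] //; split=> //; apply: contraNneq X0 => Z0;
    rewrite -subset0 -Z0.
- by rewrite disjoints_subset sub0set.
(* With [X = set0] the second alternative is impossible on both sides, so the order is equality. *)
move=> y x; rewrite (@block_le_affineP J P Pi h _ _ Delta set0 x y Pi_partition hE) //.
  by rewrite !inE; split=> [[->|[]]|[->|[]]] //; left.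
by move=> Z; rewrite (mem_minimal_singletons incD mX) sub0set andbT.
Qed.
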